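(* Let $A\in\mathbb{R}^{d\times d}$ be (symmetric) positive semidefinite, $f^*\in\mathbb{R}$, $q^*\in\mathbb{R}^d$, and $f(q)=f^*+\frac12 (q-q^* )^T A (q-q^* )$ for $q\in\mathbb{R}^d$. Let $h>0$, let $(q_k)_{k\ge 0}$ be the iterates of HB$2$ applied to $f$ with step-size $h^2$ (as defined in the context), let $p_k:=(q_k-q_{k-1})/h$ and $t_k:=hk$. For $k\ge 0$ define $$V_k = 2t_k^2\,(f(q_k)-f^* )+\|t_{k-1}p_k+(q_k-q^* )\|^2 - h\,t_k\,\langle \nabla f(q_k),\, t_{k-1}p_k+(q_k-q^* )\rangle .$$ If the step-size satisfies $h^2<\frac{4}{\lambda_{\max}(A)}$, then $V_k\ge 0$ and $V_{k+1}-V_k=0$ for all $k\ge 0$. Moreover, the suboptimality satisfies the accelerated rate $f(q_k)-f^*=O(1/k^2)$ as $k\to\infty$.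
   Context: HB$2$ (a modified Heavy-ball method) with step-size $h^2$ for a differentiable $f:\mathbb{R}^d\to\mathbb{R}$: starting from $q_0\in\mathbb{R}^d$ with zero initial velocity $p_0=0$ (i.e. $q_{-1}:=q_0$), for $k\ge 0$, $$q_{k+1}=q_k+\frac{k-1}{k+1}(q_k-q_{k-1})-h^2\,\frac{k}{k+1}\,\nabla f(q_k).$$ $\langle\cdot,\cdot\rangle$ and $\|\cdot\|$ are the Euclidean inner product and norm; $\lambda_{\max}(A)$ is the largest eigenvalue of $A$ (if it is $0$, the bound $4/\lambda_{\max}(A)$ is read as $+\infty$). *)

(* Defs.v *)
From mathcomp Require Export all_boot all_order all_algebra.
From mathcomp Require Export all_classical all_reals all_analysis.
Export numFieldNormedType.Exports.

Set Implicit Arguments.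
Unset Strict Implicit.
Unset Printing Implicit Defensive.

Import Order.TTheory GRing.Theory Num.Theory.

Local Open Scope ring_scope.
Local Open Scope classical_set_scope.

Definition inner (R : realType) (d : nat) (u v : 'cV[R]_d) : R :=
  \sum_(i < d) u i 0 * v i 0.

(* The library norm [`|u|] on matrices is the sup norm, hence this one. *)
Definition enorm (R : realType) (d : nat) (u : 'cV[R]_d) : R :=
  Num.sqrt (inner u u).

Definition grad (R : realType) (d : nat) (f : 'cV[R]_d -> R) (x : 'cV[R]_d) :
    'cV[R]_d :=
  \col_(i < d) 'D_(delta_mx i 0) f x.

Definition psd (R : realType) (d : nat) (A : 'M[R]_d) : Prop :=
  A^T = A /\ forall v : 'cV[R]_d, 0 <= (v^T *m A *m v) 0 0.

(* A matrix has finitely many eigenvalues, and a real symmetric matrix of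
   positive size has at least one; the supremum is then a maximum. *)
Definition lambda_max (R : realType) (d : nat) (A : 'M[R]_d) : R :=
  sup [set a : R | eigenvalue A a].

(* [k] ranges over [int] because t_(k-1) = -h at k = 0. *)
Definition time (R : realType) (h : R) (k : int) : R := h * k%:~R.

(* Since [0.-1 = 0] in [nat], [q k.-1] follows the convention q_(-1) := q_0,
   i.e. a zero initial velocity. *)
Definition velocity (R : realType) (d : nat) (h : R) (q : nat -> 'cV[R]_d)
    (k : nat) : 'cV[R]_d :=
  h^-1 *: (q k - q k.-1).

(* [q] is the sequence of iterates started at the arbitrary point [q 0];
   [k%:R - 1] is a subtraction in [R], equal to -1 at k = 0. *)
Definition HB2 (R : realType) (d : nat) (h : R) (f : 'cV[R]_d -> R)
    (q : nat -> 'cV[R]_d) : Prop :=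
  forall k : nat,
    q k.+1 = q k + ((k%:R - 1) / (k%:R + 1)) *: (q k - q k.-1)
             - (h ^+ 2 * (k%:R / (k%:R + 1))) *: grad f (q k).

Definition lyapunov (R : realType) (d : nat) (h : R) (f : 'cV[R]_d -> R)
    (fstar : R) (qstar : 'cV[R]_d) (q : nat -> 'cV[R]_d) (k : nat) : R :=
  let t := time h in
  let w := t (k%:Z - 1) *: velocity h q k + (q k - qstar) in
  2 * t k%:Z ^+ 2 * (f (q k) - fstar) + enorm w ^+ 2
  - h * t k%:Z * inner (grad f (q k)) w.

(* Main.v *)
Require Import Defs.
From mathcomp Require Import ring lra.

(* With y_k = k (q_k - q^* ) and w_k = (k - 1) (q_k - q_(k-1)) + (q_k - q^* ),
   HB2 becomes the symplectic-Euler-like scheme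
     w_(k+1) = w_k - h^2 A y_k,   y_(k+1) = y_k + w_(k+1),
   and V_k is the quadratic form
     h^2 <y, A y> + |w|^2 - h^2 <A y, w>
       = |w - h^2/2 A y|^2 + h^2 (<y, A y> - h^2/4 |A y|^2),
   which this scheme conserves. Since |A y|^2 <= lambda_max <y, A y>, it
   dominates h^2 (1 - h^2 lambda_max / 4) <y_k, A y_k>, a positive multiple of
   k^2 (f(q_k) - f^* ). *)

Set Implicit Arguments.
Unset Strict Implicit.
Unset Printing Implicit Defensive.

Import Order.TTheory GRing.Theory Num.Theory.
Local Open Scope ring_scope.
Local Open Scope classical_set_scope.

(** * Euclidean inner product and positive semidefinite forms *)

Section InnerProduct.
Context {R : realType} {d : nat}.
Implicit Types (u v w x y : 'cV[R]_d) (A B : 'M[R]_d) (a c : R).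

Lemma innerC u v : inner u v = inner v u.
Proof. by apply: eq_bigr => i _; rewrite mulrC. Qed.

Lemma innerDl u v w : inner (u + v) w = inner u w + inner v w.
Proof. by rewrite -big_split; apply: eq_bigr => i _; rewrite mxE mulrDl. Qed.

Lemma innerZl a u v : inner (a *: u) v = a * inner u v.
Proof. by rewrite mulr_sumr; apply: eq_bigr => i _; rewrite mxE mulrA. Qed.

Lemma innerBl u v w : inner (u - v) w = inner u w - inner v w.
Proof. by rewrite -[- v]scaleN1r innerDl innerZl mulN1r. Qed.

Lemma innerDr u v w : inner u (v + w) = inner u v + inner u w.
Proof. by rewrite innerC innerDl !(innerC u). Qed.

Lemma innerZr a u v : inner u (a *: v) = a * inner u v.
Proof. by rewrite innerC innerZl innerC. Qed.

Lemma innerBr u v w : inner u (v - w) = inner u v - inner u w.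
Proof. by rewrite innerC innerBl !(innerC u). Qed.

Lemma inner_ge0 u : 0 <= inner u u.
Proof. by apply: sumr_ge0 => i _; rewrite -expr2 sqr_ge0. Qed.

Lemma inner_eq0 u : (inner u u == 0) = (u == 0).
Proof.
rewrite psumr_eq0; last by move=> i _; rewrite -expr2 sqr_ge0.
apply/allP/eqP => [u0|-> i _]; last by rewrite !mxE mulr0 eqxx.
apply/colP => i; rewrite mxE; apply/eqP; rewrite -sqrf_eq0 expr2.
exact: u0 i (mem_index_enum i).
Qed.

Lemma enorm_sqr u : enorm u ^+ 2 = inner u u.
Proof. by rewrite sqr_sqrtr ?inner_ge0. Qed.

Lemma inner_mulmx A u v : inner u (A *m v) = inner (A^T *m u) v.
Proof.
have dotE x y : inner x y = (x^T *m y) 0 0.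
  by rewrite mxE; apply: eq_bigr => i _; rewrite mxE.
by rewrite !dotE trmx_mul trmxK mulmxA.
Qed.

Lemma quadE A v : (v^T *m A *m v) 0 0 = inner v (A *m v).
Proof.
by rewrite -mulmxA mxE; apply: eq_bigr => i _; rewrite mxE.
Qed.

Lemma psd_inner_ge0 A v : psd A -> 0 <= inner v (A *m v).
Proof. by case=> _ /(_ v); rewrite quadE. Qed.

Lemma psd_inner_sym A u v : psd A -> inner u (A *m v) = inner v (A *m u).
Proof. by case=> symA _; rewrite inner_mulmx symA innerC. Qed.

(** The form of [B] at [u + t *: v] is a quadratic polynomial in [t] that is never negative. Its
    leading coefficient may vanish. *)
Lemma psd_cauchy_schwarz B u v : psd B ->
  inner u (B *m v) ^+ 2 <= inner u (B *m u) * inner v (B *m v).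
Proof.
move=> psdB.
have quad_ge0 t : 0 <= inner u (B *m u) + 2 * t * inner u (B *m v)
                       + t ^+ 2 * inner v (B *m v).
  have := psd_inner_ge0 (u + t *: v) psdB.
  rewrite mulmxDr -scalemxAr !(innerDl, innerDr, innerZl, innerZr).
  rewrite (psd_inner_sym v u psdB).
  by congr (_ <= _); ring.
have c_ge0 := psd_inner_ge0 v psdB.
move: (inner u (B *m u)) (inner u (B *m v)) (inner v (B *m v)) quad_ge0 c_ge0.
move=> a b c quad_ge0; rewrite le0r => /orP[/eqP c0|c_gt0].
  have [->|b_neq0] := eqVneq b 0; first by rewrite c0 mulr0 expr0n.
  (* When [c = 0] the polynomial is affine, and this [t] gives it the value -1. *)
  have := quad_ge0 (- (a + 1) / (2 * b)); rewrite c0.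
  have -> : a + 2 * (- (a + 1) / (2 * b)) * b
            + (- (a + 1) / (2 * b)) ^+ 2 * 0 = -1 by field.
  by rewrite lerNr oppr0 ler10.
(* The minimiser of the polynomial. *)
have := quad_ge0 (- b / c).
have -> : a + 2 * (- b / c) * b + (- b / c) ^+ 2 * c = (a * c - b ^+ 2) / c.
  by field; rewrite gt_eqF.
by rewrite pmulr_lge0 ?invr_gt0// subr_ge0.
Qed.

Lemma inner_mulmx_bounded A :
  exists2 K, 0 < K & forall v, inner v (A *m v) <= K * inner v v.
Proof.
have sum_ge0 : 0 <= \sum_(i < d) \sum_(j < d) `|A i j|.
  by apply: sumr_ge0 => i _; apply: sumr_ge0.
exists (1 + \sum_(i < d) \sum_(j < d) `|A i j|); first lra.
move=> v; have := inner_ge0 v => vv_ge0.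
apply: (@le_trans _ _ ((\sum_(i < d) \sum_(j < d) `|A i j|) * inner v v));
  last by apply: ler_wpM2r => //; rewrite lerDr.
have sqr_le i : v i 0 ^+ 2 <= inner v v.
  rewrite /inner (bigD1 i)//= -expr2 lerDl.
  by apply: sumr_ge0 => j _; rewrite -expr2 sqr_ge0.
rewrite mulr_suml; apply: ler_sum => i _.
rewrite mxE mulr_sumr mulr_suml; apply: ler_sum => j _.
apply: (le_trans (ler_norm _)); rewrite mulrCA !normrM; apply: ler_wpM2l => //.
(* Each product of entries is bounded via [2|v_i||v_j| <= v_i^2 + v_j^2 <= 2 |v|^2]. *)
have := sqr_ge0 (`|v i 0| - `|v j 0|).
have := sqr_le i; have := sqr_le j.
rewrite -(real_normK (num_real (v i 0))) -(real_normK (num_real (v j 0))).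
nra.
Qed.

End InnerProduct.

(** * The largest eigenvalue as a bound on the quadratic form *)

(* If [c] were not an eigenvalue, Cauchy-Schwarz for the form [B = c - A]
   applied to [B^-1 v] and [v] would make [B] uniformly positive definite, so
   [c] could be decreased. *)
Lemma rayleigh_infimum_eigenvalue (R : realType) (d : nat) (A : 'M[R]_d)
    (c : R) : A^T = A ->
  (forall v : 'cV[R]_d, inner v (A *m v) <= c * inner v v) ->
  (forall c' : R, (forall v : 'cV[R]_d, inner v (A *m v) <= c' * inner v v) ->
     c <= c') ->
  eigenvalue A c.
Proof.
move=> symA c_ub c_min; apply: contraT => c_noteig.
pose B := c%:M - A.
have BE (v : 'cV[R]_d) : inner v (B *m v) = c * inner v v - inner v (A *m v).
  by rewrite mulmxBl mul_scalar_mx innerBr innerZr.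
have psdB : psd B.
  split=> [|v]; first by rewrite /B linearB /= tr_scalar_mx symA.
  by rewrite quadE BE subr_ge0.
have Bunit : B \in unitmx.
  (* As [B = -(A - c)], every row of its kernel lies in the eigenspace of [A] for [c], which is
     zero. *)
  rewrite -row_free_unit -kermx_eq0; move: c_noteig.
  rewrite /eigenvalue /eigenspace negbK -opprB -/B => /eqP ker0.
  apply/eqP/row_matrixP => i; rewrite row0; apply/eqP.
  rewrite -submx0 -ker0; apply/sub_kermxP.
  by rewrite mulmxN -row_mul mulmx_ker row0 oppr0.
have [K K_gt0 K_ub] := inner_mulmx_bounded (invmx B).
have Kinv_gt0 : 0 < K^-1 by rewrite invr_gt0.
suff /c_min : forall v : 'cV[R]_d, inner v (A *m v) <= (c - K^-1) * inner v v.
  by lra.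
move=> v; have [->|v_neq0] := eqVneq v 0.
  by rewrite mulmx0 -(scale0r 0) !innerZl mul0r mulr0.
have vv_gt0 : 0 < inner v v by rewrite lt0r inner_eq0 v_neq0 inner_ge0.
(* The cross term is [|v|^2] and the form at [B^-1 v] is at most [K |v|^2], so
   [|v|^4 <= K |v|^2 <v, B v>]. *)
have := psd_cauchy_schwarz (invmx B *m v) v psdB.
rewrite (psd_inner_sym (invmx B *m v) v psdB) mulKVmx//.
rewrite (innerC (invmx B *m v)) => cs.
have := K_ub v; have := psd_inner_ge0 v psdB => Bv_ge0 Kv.
have : inner v v ^+ 2 <= K * inner v v * inner v (B *m v).
  by apply: (le_trans cs); apply: ler_wpM2r.
rewrite expr2 mulrAC ler_pM2r// -ler_pdivrMl// BE.
lra.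
Qed.

(** The least constant bounding the Rayleigh quotient is itself an eigenvalue, hence at most the
    supremum of the eigenvalues. In dimension 0 both sides vanish. *)
Lemma inner_le_lambda_max (R : realType) (d : nat) (A : 'M[R]_d)
    (v : 'cV[R]_d) : psd A -> inner v (A *m v) <= lambda_max A * inner v v.
Proof.
case: d A v => [A v _|d A v psdA]; first by rewrite /inner !big_ord0 mulr0.
pose S := [set c : R | forall v : 'cV[R]_d.+1, inner v (A *m v) <= c * inner v v].
have S0 : S !=set0 by have [K _ Kub] := inner_mulmx_bounded A; exists K.
have lbS (w : 'cV[R]_d.+1) : w != 0 -> lbound S (inner w (A *m w) / inner w w).
  move=> w0 c /(_ w); rewrite ler_pdivrMr//.
  by rewrite lt0r inner_eq0 w0 inner_ge0.
have delta_neq0 : delta_mx 0 0 != 0 :> 'cV[R]_d.+1.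
  by apply/eqP => /matrixP/(_ 0 0)/eqP; rewrite !mxE eqxx oner_eq0.
have infS_ub : S (inf S).
  move=> w; have [->|w0] := eqVneq w 0.
    by rewrite mulmx0 -(scale0r 0) !innerZl !mul0r mulr0.
  rewrite -ler_pdivrMr; last by rewrite lt0r inner_eq0 w0 inner_ge0.
  by apply: lb_le_inf => //; apply: lbS.
have infS_eig : eigenvalue A (inf S).
  apply: rayleigh_infimum_eigenvalue => //; first by case: psdA.
  by move=> c Sc; apply: ge_inf => //; eexists; exact: lbS delta_neq0.
apply: (le_trans (infS_ub v)); apply: ler_wpM2r; first exact: inner_ge0.
(* The supremum is meaningful because [inf S] bounds every eigenvalue: test it on an eigenvector,
   transposed since [eigenvalue] uses row vectors. *)
apply: ub_le_sup => //; exists (inf S) => a /eigenvalueP[u uA u0].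
have := infS_ub u^T.
have -> : A *m u^T = a *: u^T.
  by case: psdA => symA _; rewrite -[A in LHS]symA -trmx_mul uA linearZ.
rewrite innerZr ler_pM2r// lt0r inner_eq0 inner_ge0 andbT.
by rewrite -(inj_eq trmx_inj) trmxK trmx0.
Qed.

(** Cauchy-Schwarz for the form of [A] at [A y] and [y] gives [|A y|^4 <= <A y, A A y> <y, A y>];
    bound the first factor by [lambda_max A] and divide by [|A y|^2]. *)
Lemma inner_mulmx_sqr_le (R : realType) (d : nat) (A : 'M[R]_d)
    (y : 'cV[R]_d) : psd A ->
  inner (A *m y) (A *m y) <= lambda_max A * inner y (A *m y).
Proof.
move=> psdA; have [Ay0|Ay_neq0] := eqVneq (A *m y) 0.
  by rewrite Ay0 -[X in inner y X](scale0r 0) innerZr -(scale0r 0) innerZl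
    !mul0r mulr0.
have Ay_gt0 : 0 < inner (A *m y) (A *m y).
  by rewrite lt0r inner_eq0 Ay_neq0 inner_ge0.
have := psd_cauchy_schwarz (A *m y) y psdA.
have := inner_le_lambda_max (A *m y) psdA.
have := psd_inner_ge0 y psdA => yAy_ge0 AyAAy cs.
have : inner (A *m y) (A *m y) ^+ 2
    <= lambda_max A * inner (A *m y) (A *m y) * inner y (A *m y).
  by apply: (le_trans cs); apply: ler_wpM2r.
by rewrite expr2 mulrAC ler_pM2r.
Qed.

(** * Gradient of the quadratic objective *)

Lemma grad_quadratic (R : realType) (d : nat) (A : 'M[R]_d) (fstar : R)
    (qstar : 'cV[R]_d) (f : 'cV[R]_d -> R) (x : 'cV[R]_d) : A^T = A ->
  (forall x, f x = fstar + 2^-1 * inner (x - qstar) (A *m (x - qstar))) ->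
  grad f x = A *m (x - qstar).
Proof.
move=> symA fE; apply/colP => i; rewrite mxE /derive.
set e : 'cV[R]_d := delta_mx i 0; set z := x - qstar.
have eE (u : 'cV[R]_d) : inner e u = u i 0.
  rewrite /inner (bigD1 i)//= big1 ?addr0 => [|j /negPf ji].
    by rewrite /e mxE !eqxx mul1r.
  by rewrite /e mxE ji mul0r.
apply: cvg_lim => //.
(* For [t != 0] the difference quotient equals this affine function of [t] exactly. *)
have : (A *m z) i 0 + t * (2^-1 * inner e (A *m e)) @[t --> 0^']
    --> (A *m z) i 0 + 0 * (2^-1 * inner e (A *m e)).
  apply: cvgD; first exact: cvg_cst.
  apply: cvgM; last exact: cvg_cst.
  exact: cvg_within.
rewrite mul0r addr0; apply: cvg_trans; apply: near_eq_cvg.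
near=> t => /=.
have t_neq0 : t != 0 by near: t; exact: nbhs_dnbhs_neq.
rewrite !fE -(addrA _ x) -/z; clearbody z.
rewrite mulmxDr -scalemxAr.
rewrite !(innerDl, innerDr, innerZl, innerZr) eE.
rewrite [inner z (A *m e)]inner_mulmx symA [inner _ e]innerC eE.
rewrite /GRing.scale /=; by field.
Unshelve. all: by end_near. Qed.

(** * The conserved quadratic form and its lower bound *)

Definition energy (R : realType) (d : nat) (A : 'M[R]_d) (h : R)
    (y w : 'cV[R]_d) : R :=
  h ^+ 2 * inner y (A *m y) + inner w w - h ^+ 2 * inner (A *m y) w.

Lemma energy_step (R : realType) (d : nat) (A : 'M[R]_d) (h : R)
    (y w w' : 'cV[R]_d) : A^T = A -> w' = w - h ^+ 2 *: (A *m y) ->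
  energy A h (y + w') w' = energy A h y w.
Proof.
move=> symA w'E.
(* Expressing the old [w] through [w'] reduces the claim to a polynomial identity in inner products
   of [y], [w'] and their images. *)
have -> : energy A h y w = energy A h y (w' + h ^+ 2 *: (A *m y)).
  by rewrite w'E subrK.
rewrite /energy mulmxDr !(innerDl, innerDr, innerZl, innerZr).
rewrite (inner_mulmx A y w') symA (innerC w' (A *m y)) (innerC w' (A *m w')).
by ring.
Qed.

Lemma energy_lower_bound (R : realType) (d : nat) (A : 'M[R]_d) (h : R)
    (y w : 'cV[R]_d) : psd A ->
  h ^+ 2 * (1 - h ^+ 2 * lambda_max A / 4) * inner y (A *m y)
    <= energy A h y w.
Proof.
move=> psdA; have h4_ge0 : 0 <= h ^+ 2 * h ^+ 2 by rewrite mulr_ge0 ?sqr_ge0.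
have := ler_wpM2l h4_ge0 (inner_mulmx_sqr_le y psdA).
have := inner_ge0 (w - (h ^+ 2 / 2) *: (A *m y)).
rewrite /energy !(innerBl, innerBr, innerZl, innerZr) (innerC w).
lra.
Qed.

(** A zero [lambda_max A] makes the claim [0 < 4]; otherwise [0 < h^2 < 4 / lambda_max A] forces it
    to be positive, and one can cross-multiply. *)
Lemma lte_divr_lambda_max (R : realType) (d : nat) (A : 'M[R]_d) (h : R) :
  0 < h -> ((h ^+ 2)%:E < 4%:E / (lambda_max A)%:E)%E ->
  h ^+ 2 * lambda_max A < 4.
Proof.
move=> h_gt0; have [->|L_neq0] := eqVneq (lambda_max A) 0.
  by rewrite mulr0 ltr0n.
rewrite inver (negPf L_neq0) -EFinM lte_fin => h2_lt.
have L_gt0 : 0 < lambda_max A.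
  rewrite -invr_gt0 -(pmulr_rgt0 _ (ltr0n R 4)).
  by apply: lt_trans h2_lt; rewrite exprn_gt0.
by rewrite -ltr_pdivlMr.
Qed.

(** * The HB2 iterates in the variables [y] and [w] *)

Section HB2Iterates.
Context {R : realType} {d : nat} (A : 'M[R]_d) (fstar : R) (qstar : 'cV[R]_d).
Context (f : 'cV[R]_d -> R) (h : R) (q : nat -> 'cV[R]_d).
Hypotheses (symA : A^T = A) (h_gt0 : 0 < h) (hq : HB2 h f q).
Hypothesis fE : forall x,
  f x = fstar + 2^-1 * inner (x - qstar) (A *m (x - qstar)).

Let y k : 'cV[R]_d := k%:R *: (q k - qstar).
Let w k : 'cV[R]_d := (k%:R - 1) *: (q k - q k.-1) + (q k - qstar).

Lemma lyapunov_energy k : lyapunov h f fstar qstar q k = energy A h (y k) (w k).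
Proof.
have h_neq0 : h != 0 by rewrite gt_eqF.
have wE : time h (k%:Z - 1) *: velocity h q k + (q k - qstar) = w k.
  rewrite /w /time /velocity scalerA; congr (_ *: _ + _).
  by rewrite mulrAC mulfV// mul1r rmorphB.
rewrite /lyapunov wE enorm_sqr (grad_quadratic _ symA fE) fE /time /energy /y.
rewrite -scalemxAr !(innerZl, innerZr) -pmulrn.
by field.
Qed.

(** Write [w k.+1] as [(k + 1) (q_(k+1) - q_k) + (q_k - q^* )]; the factor [k + 1] clears the
    denominators of the recursion. *)
Lemma HB2_momentum k : w k.+1 = w k - h ^+ 2 *: (A *m y k).
Proof.
have k1_neq0 : k%:R + 1 != 0 :> R by rewrite natr1 pnatr_eq0.
have := hq k; rewrite (grad_quadratic _ symA fE) /w /y -scalemxAr => /colP hqk.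
apply/colP => i; move: (hqk i); rewrite !mxE /= => ->; rewrite -natr1.
by field.
Qed.

Lemma HB2_position k : y k.+1 = y k + w k.+1.
Proof.
by apply/colP => i; rewrite !mxE /= -natr1; ring.
Qed.

Lemma lyapunov_step k :
  lyapunov h f fstar qstar q k.+1 = lyapunov h f fstar qstar q k.
Proof.
by rewrite !lyapunov_energy HB2_position; apply/energy_step/HB2_momentum.
Qed.

End HB2Iterates.

(* In [\bar R], [x / 0 = +oo] for [0 < x], so the step-size condition is void
   when [lambda_max A = 0]. *)
Theorem proposition4 (R : realType) (d : nat) (A : 'M[R]_d) (fstar : R)
    (qstar : 'cV[R]_d) (f : 'cV[R]_d -> R) (h : R) (q : nat -> 'cV[R]_d)
    (hA : psd A)
    (hf : forall x : 'cV[R]_d,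
        f x = fstar + 2^-1 * ((x - qstar)^T *m A *m (x - qstar)) 0 0)
    (h_gt0 : 0 < h)
    (hq : HB2 h f q)
    (hstep : ((h ^+ 2)%:E < 4%:E / (lambda_max A)%:E)%E) :
  (forall k : nat,
      0 <= lyapunov h f fstar qstar q k
      /\ lyapunov h f fstar qstar q k.+1 - lyapunov h f fstar qstar q k = 0)
  /\ (fun k : nat => f (q k) - fstar : R^o) =O_\oo
       (fun k : nat => (k%:R ^+ 2)^-1 : R^o).
Proof.
have fE x : f x = fstar + 2^-1 * inner (x - qstar) (A *m (x - qstar)).
  by rewrite hf quadE.
have [symA _] := hA.
have /(_ h_gt0)/(_ hstep) h2L := @lte_divr_lambda_max R d A h.
set c := 1 - h ^+ 2 * lambda_max A / 4.
have h2c_gt0 : 0 < h ^+ 2 * c.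
  by rewrite mulr_gt0 ?exprn_gt0// /c; lra.
(* The factor 2 arises from [<y_k, A y_k> = 2 k^2 (f(q_k) - f^* )]. *)
have V_ge k :
    2 * (h ^+ 2 * c) * (k%:R ^+ 2 * (f (q k) - fstar))
    <= lyapunov h f fstar qstar q k.
  rewrite (lyapunov_energy q symA h_gt0 fE).
  apply: le_trans (energy_lower_bound _ _ _ hA).
  rewrite fE -scalemxAr innerZl innerZr -/c.
  by rewrite le_eqVlt; apply/orP; left; apply/eqP; field.
have gap_ge0 x : 0 <= f x - fstar.
  by rewrite fE addrC addKr mulr_ge0 ?invr_ge0// psd_inner_ge0.
have V_const k : lyapunov h f fstar qstar q k = lyapunov h f fstar qstar q 0.
  by elim: k => // k IH; rewrite (lyapunov_step symA h_gt0 hq fE).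
split=> [k|].
  split; last by rewrite (lyapunov_step symA h_gt0 hq fE) subrr.
  apply: le_trans (V_ge k).
  apply: mulr_ge0; first by rewrite mulr_ge0// ltW.
  by rewrite mulr_ge0 ?sqr_ge0 ?gap_ge0.
(* Conservation turns [V_ge] into a bound by [V_0]; adding 1 keeps the constant positive. *)
apply/eqO_exP; exists (1 + `|lyapunov h f fstar qstar q 0 / (2 * (h ^+ 2 * c))|).
  by rewrite ltr_pwDl.
near=> k.
have k_gt0 : 0 < k%:R :> R by rewrite ltr0n; near: k; exact: nbhs_infty_gt.
have k2_gt0 : 0 < k%:R ^+ 2 :> R by rewrite exprn_gt0.
rewrite (ger0_norm (gap_ge0 _)) [X in _ <= _ * X]gtr0_norm ?invr_gt0//.
rewrite ler_pdivlMr// mulrC.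
apply: (@le_trans _ _ `|lyapunov h f fstar qstar q 0 / (2 * (h ^+ 2 * c))|).
  apply: le_trans (ler_norm _).
  rewrite ler_pdivlMr; last by apply: mulr_gt0.
  by have := V_ge k; rewrite V_const; lra.
by rewrite lerDr.
Unshelve. all: by end_near. Qed.
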